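(* Let $\mu\in\mathcal F$ and let $E$ be a Borel set of $\mathbb R$ with measure $\mu(E)=p$. Put $\alpha_p=-F^{-1}\left(\frac{1-p}{2}\right)$ and $\beta_p=\alpha_{1-p}=-F^{-1}\left(\frac p2\right)$. Then: (i) if $p<1/2$, $P(E)\ge P\big((-\infty,-\beta_p)\cup(\beta_p,+\infty)\big)$, with equality if and only if $E=(-\infty,-\beta_p)\cup(\beta_p,+\infty)$; (ii) if $p>1/2$, $P(E)\ge P\big((-\alpha_p,\alpha_p)\big)$, with equality if and only if $E=(-\alpha_p,\alpha_p)$; (iii) if $p=1/2$, $P(E)\ge P\big((-\infty,-\beta_p)\cup(\beta_p,+\infty)\big)=P\big((-\alpha_p,\alpha_p)\big)$, with equality if and only if $E$ equals $(-\infty,-\beta_p)\cup(\beta_p,+\infty)$ or $(-\alpha_p,\alpha_p)$.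
   Context: $\mathcal F$ is the class of probability measures $\mu$ on $\mathbb R$ with no atoms and with density $f$ (with respect to Lebesgue measure), symmetric with respect to the origin, which are strictly log-convex, i.e. $\log f$ is strictly convex on $(-\infty,0)$ and on $(0,+\infty)$, and whose distribution function $F(x)=\mu((-\infty,x])$ satisfies $\inf\{x\in\mathbb R:F(x)>0\}=-\infty$ and $\sup\{x\in\mathbb R:F(x)<1\}=+\infty$. $F^{-1}$ is the inverse of $F$, with $F^{-1}(0)=-\infty$, $F^{-1}(1)=+\infty$; intervals such as $(\infty,\infty)$ are empty. The $\mu$-perimeter of a Borel set $E$ is $P(E)=\int_{\partial^M E}f\,d\mathcal H^0=\sum_{x\in\partial^M E}f(x)$, where $\mathcal H^0$ is the $0$-dimensional Hausdorff (counting) measure and $\partial^M E$ is the essential boundary of $E$ (the points of $\mathbb R$ at which $E$ has neither Lebesgue density $0$ nor Lebesgue density $1$).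
   Formalization: Equality of E with the extremal sets is taken up to Lebesgue-null sets (closed intervals also give equality), and the density f is taken continuous at 0, possibly with f(0)=+∞ (if f(0)=0, E=(0,+∞) has perimeter 0 at p=1/2). *)

(* Defs.v *)
From HB Require Import structures.
From mathcomp Require Import all_boot all_order all_algebra.
From mathcomp Require Import all_classical all_reals all_analysis.
From mathcomp Require Import measurable_realfun.

Set Implicit Arguments.
Unset Strict Implicit.
Unset Printing Implicit Defensive.

Import Order.TTheory GRing.Theory Num.Theory.
Import numFieldNormedType.Exports.

Local Open Scope classical_set_scope.
Local Open Scope ring_scope.

Definition strictly_convex_on (R : realType) (D : set R) (g : R -> R) : Prop :=
  forall x y t : R, D x -> D y -> x != y -> 0 < t < 1 ->
    g (t * x + (1 - t) * y) < t * g x + (1 - t) * g y.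

Definition distr_fun (R : realType) (mu : probability (measurableTypeR R) R)
  (x : R) : R := fine (mu `]-oo, x]%classic).

(* The inverse of F on ]0, 1[ (where the preimage of q is a single point for the
   measures considered here), with the conventions F^-1(0) = -oo and
   F^-1(1) = +oo. *)
Definition distr_inv (R : realType) (mu : probability (measurableTypeR R) R)
    (q : R) : \bar R :=
  if q == 0 then -oo%E
  else if q == 1 then +oo%E
  else (xget 0 (distr_fun mu @^-1` [set q]))%:E.

(* "mu belongs to the class F, with density f".
   The density is a pointwise function because the perimeter evaluates it at
   points. Strict convexity of log f makes f positive, finite and continuous
   off the origin, but leaves f 0 (a null set) undetermined; lcf_cont0 selects
   the representative that is continuous at 0. As f may blow up at the origin,
   e.g. like |x| `^ (- 2^-1), f takes extended real values and f 0 may be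
   +oo. *)
Record log_convex_class (R : realType) (mu : probability (measurableTypeR R) R)
    (f : R -> \bar R) : Prop := {
  lcf_no_atoms : forall x : R, mu [set x] = 0%E ;
  lcf_ge0 : forall x : R, (0 <= f x)%E ;
  lcf_meas : measurable_fun [set: R] f ;
  lcf_density : forall A : set (measurableTypeR R), measurable A ->
    mu A = (\int[@lebesgue_measure R]_(x in A) f x)%E ;
  lcf_sym : forall A : set (measurableTypeR R), measurable A ->
    mu (-%R @^-1` A) = mu A ;
  (* log f is real-valued off the origin *)
  lcf_pos_fin : forall x : R, x != 0 -> (0 < f x < +oo)%E ;
  lcf_convex_neg : strictly_convex_on `]-oo, 0[ (fun x => ln (fine (f x))) ;
  lcf_convex_pos : strictly_convex_on `]0, +oo[ (fun x => ln (fine (f x))) ;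
  lcf_cont0 : {for 0, continuous f} ;
  lcf_inf_supp : ereal_inf [set x%:E | x in [set x | 0 < distr_fun mu x]] = -oo%E ;
  lcf_sup_supp : ereal_sup [set x%:E | x in [set x | distr_fun mu x < 1]] = +oo%E
}.

Definition has_density (R : realType) (E : set R) (x d : R) : Prop :=
  (lebesgue_measure (E `&` ball x r) * (lebesgue_measure (ball x r))^-1)%E
    @[r --> 0^'+] --> d%:E.

Definition ess_boundary (R : realType) (E : set R) : set R :=
  [set x | ~ has_density E x 0 /\ ~ has_density E x 1].

Definition perimeter (R : realType) (f : R -> \bar R) (E : set R) : \bar R :=
  \esum_(x in ess_boundary E) f x.

Definition alpha (R : realType) (mu : probability (measurableTypeR R) R)
  (p : R) : \bar R := (- distr_inv mu ((1 - p) / 2))%E.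

Definition beta (R : realType) (mu : probability (measurableTypeR R) R)
  (p : R) : \bar R := alpha mu (1 - p).

Lemma betaE (R : realType) (mu : probability (measurableTypeR R) R) (p : R) :
  beta mu p = (- distr_inv mu (p / 2))%E.
Proof. by rewrite /beta /alpha opprB addrC subrK. Qed.

(* Sets of real numbers whose end points may be infinite. *)
Definition two_rays (R : realType) (b : \bar R) : set R :=
  [set x : R | (x%:E < - b)%E] `|` [set x : R | (b < x%:E)%E].

Definition sym_itv (R : realType) (a : \bar R) : set R :=
  [set x : R | (- a < x%:E < a)%E].

(* Equality of Borel sets is understood up to Lebesgue-null sets: the measure
   and the perimeter do not change when a set is modified on a null set. *)
Definition eq_mod_null (R : realType) (A B : set R) : Prop :=
  lebesgue_measure (A `+` B) = 0%E.

(* Main.v *)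
Require Import Defs.
From HB Require Import structures.
From mathcomp Require Import all_boot all_order all_algebra.
From mathcomp Require Import all_classical all_reals all_analysis.
From mathcomp Require Import measurable_realfun.
From mathcomp Require Import ring lra.

Set Implicit Arguments.
Unset Strict Implicit.
Unset Printing Implicit Defensive.

Import Order.TTheory GRing.Theory Num.Theory.
Import numFieldNormedType.Exports.

Local Open Scope classical_set_scope.
Local Open Scope ring_scope.

(** Let [b > 0] with [mu (two_rays b) = p <= 1/2]. As [ln f] is convex,
    [f] lies above an exponential [h] of some rate [- k] touching it at [b], and
    [f / h] is nonincreasing on the left of [b]. Integrating over [x, b] and over
    [b, c] gives [k * mu [x, b] < f x - f b] and [f b - f c <= k * mu [b, c]], so
    that [f x + f c > 2 * f b] whenever [0 <= x < b < c] and the tails at [x] and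
    [c] add up to [p] (convexity of the isoperimetric function of half-lines).

    If the essential boundary of [E] has two points in []- b, b[], then
    [P(E) > 2 * f b] as [f] decreases away from 0. If it has none there, [E] is
    null or conull in []- b, b[], which with [mu E = p] forces [E] to be
    one of the two extremal sets. If it has exactly one, at [x >= 0] say, then, up
    to a complement, [E] is null on []- b, x[], and its mass forces a second
    boundary point [a] with [- c <= a <= - b], where the tails at [x] and [c] add
    up to [p]; hence [P(E) >= f x + f a > 2 * f b]. *)

(** * Support lines of strictly convex functions *)

(** Convexity with the barycentric weights of [b] between [x] and [y], cleared of denominators. *)
Lemma strictly_convex_chord (R : realType) (g : R -> R) (x b y : R) :
  strictly_convex_on `]0, +oo[ g -> 0 < x -> x < b -> b < y ->
  (y - x) * g b < (y - b) * g x + (b - x) * g y.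
Proof.
move=> cg x0 xb byy.
have yx : 0 < y - x by lra.
have := cg x y ((y - b) / (y - x)).
rewrite /= !in_itv/= !andbT x0 (lt_trans x0 (lt_trans xb byy)).
move=> /(_ isT isT); rewrite lt_eqF ?(lt_trans xb byy)// => /(_ isT).
have t01 : 0 < (y - b) / (y - x) < 1.
  apply/andP; split; first by apply: divr_gt0; lra.
  by rewrite ltr_pdivrMr//; lra.
move=> /(_ t01).
have -> : 1 - (y - b) / (y - x) = (b - x) / (y - x) by field; lra.
have -> : (y - b) / (y - x) * x + (b - x) / (y - x) * y = b by field; lra.
rewrite -(ltr_pM2l yx) => /lt_le_trans; apply.
rewrite le_eqVlt; apply/orP; left; apply/eqP; field; lra.
Qed.

(** The slope [s] is the supremum of the slopes of chords ending at [b] from the left. Every chord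
    slope to the right of [b] bounds these from above, which gives the weak inequality on both
    sides. *)
Lemma strictly_convex_support (R : realType) (g : R -> R) (b : R) :
  strictly_convex_on `]0, +oo[ g -> 0 < b ->
  exists s, forall x, 0 < x -> x != b -> g b + s * (x - b) < g x.
Proof.
move=> cg b0.
pose slope x := (g x - g b) / (x - b).
pose A := [set slope x | x in [set x | 0 < x < b]].
have slope_lt x y : 0 < x -> x < b -> b < y -> slope x <= slope y.
  move=> x0 xb by_; have := strictly_convex_chord cg x0 xb by_.
  rewrite /slope ler_pdivlMr ?subr_gt0// mulrAC -mulrN1 => h.
  rewrite ler_ndivrMr ?subr_lt0//; lra.
have Aub y : b < y -> ubound A (slope y).
  by move=> by_ _ [x /andP[x0 xb] <-]; exact: slope_lt.
have supA : has_sup A.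
  split; last by exists (slope (b + 1)); apply: Aub; lra.
  by exists (slope (b / 2)), (b / 2) => //=; apply/andP; split; lra.
have weak x : 0 < x -> g b + sup A * (x - b) <= g x.
  move=> x0; have [xb|bx|->] := ltgtP x b; last by rewrite subrr mulr0 addr0.
    have : slope x <= sup A.
      by apply: ub_le_sup; [exact: supA.2|exists x => //=; rewrite x0 xb].
    by rewrite /slope ler_ndivrMr ?subr_lt0// => h; lra.
  have : sup A <= slope x by apply: ge_sup; [exact: supA.1|exact: Aub].
  by rewrite /slope ler_pdivlMr ?subr_gt0// => h; lra.
exists (sup A) => x x0 xb.
(* Strictness at [x] comes from the weak bound at the midpoint of [x] and [b], where [g] is strictly
   below its chord. *)
have := weak (2^-1 * x + (1 - 2^-1) * b) ltac:(lra).
have := cg x b 2^-1; rewrite /= !in_itv/= x0 b0 => /(_ isT isT xb ltac:(lra)).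
by move=> h1 h2; have := le_lt_trans h2 h1; lra.
Qed.

(** The chord over [[x, u]] is no steeper than the one over [[x, b]], whose slope is at most [s] by
    the support inequality at [x]. *)
Lemma strictly_convex_subline (R : realType) (g : R -> R) (s b x u : R) :
  strictly_convex_on `]0, +oo[ g ->
  (forall x, 0 < x -> x != b -> g b + s * (x - b) < g x) ->
  0 < x -> x <= u -> u <= b -> g u - s * (u - x) <= g x.
Proof.
move=> cg sup x0; rewrite le_eqVlt => /predU1P[->|xu].
  by rewrite subrr mulr0 subr0.
rewrite le_eqVlt => /predU1P[->|ub].
  have := sup x x0; case: eqP => [->|_ /(_ isT)]; lra.
have := strictly_convex_chord cg x0 xu ub.
have := sup x x0 ltac:(lra).
move=> h1 h2.
have : (u - x) * (g b + s * (x - b)) < (u - x) * g x by rewrite ltr_pM2l//; lra.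
by move=> h3; rewrite -(@ler_pM2l _ (b - x)); lra.
Qed.

(** * The essential boundary *)

Lemma le_measure_mod_null d (T : measurableType d) (R : realType)
    (mu : {measure set T -> \bar R}) (A B : set T) :
  measurable A -> measurable B -> mu (A `\` B) = 0%E -> (mu A <= mu B)%E.
Proof.
move=> mA mB AB0; rewrite -[leRHS]adde0 -AB0.
apply: (@le_trans _ _ (mu (B `|` A `\` B))).
  apply: le_measure; rewrite ?inE//; last first.
    by move=> x Ax; have [] := pselect (B x); [left|right].
  by apply: measurableU => //; exact: measurableD.
by apply: measureU2 => //; exact: measurableD.
Qed.

Lemma eq_mod_nullP (R : realType) (A B : set R) :
  measurable (A : set (measurableTypeR R)) ->
  measurable (B : set (measurableTypeR R)) ->
  eq_mod_null A B <->
  lebesgue_measure (A `\` B) = 0%E /\ lebesgue_measure (B `\` A) = 0%E.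
Proof.
move=> mA mB.
have mAB : measurable (A `\` B : set (measurableTypeR R)) by exact: measurableD.
have mBA : measurable (B `\` A : set (measurableTypeR R)) by exact: measurableD.
rewrite /eq_mod_null; split=> [h|[h1 h2]].
  by split; apply: (subset_measure0 _ _ _ h) => //; try exact: measurableU;
    move=> x ABx; (by left) || (by right).
apply/eqP; rewrite -measure_le0 -[leRHS]adde0.
rewrite -[X in (X + _)%E]h1 -[X in (_ + X)%E]h2.
exact: measureU2.
Qed.

Section essential_boundary.
Context {R : realType}.
Local Notation lam := (@lebesgue_measure R).
Implicit Types (E A B : set (measurableTypeR R)) (x c r e : R).

Lemma eq_mod_null_sym A B : eq_mod_null A B -> eq_mod_null B A.
Proof. by rewrite /eq_mod_null setYC. Qed.

Lemma eq_mod_null_setC A B : eq_mod_null (~` A) (~` B) <-> eq_mod_null A B.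
Proof.
rewrite /eq_mod_null (_ : ~` A `+` ~` B = A `+` B)//.
apply/seteqP; split=> x; rewrite /setY/=;
  case: (pselect (A x)); case: (pselect (B x)); tauto.
Qed.

Lemma eq_mod_null_setI A B E : measurable A -> measurable B -> measurable E ->
  eq_mod_null A B -> lam (A `&` E) = lam (B `&` E).
Proof.
move=> mA mB mE /eq_mod_nullP-/(_ mA mB)[AB BA].
have mI X : measurable X -> measurable (X `&` E).
  by move=> mX; exact: measurableI.
have sub X Y : (X `&` E) `\` (Y `&` E) `<=` X `\` Y.
  by move=> x [[Xx Ex] nYE]; split => // Yx; exact: nYE.
apply/eqP; rewrite eq_le; apply/andP; split; apply: le_measure_mod_null;
  try exact: mI.
- by apply: (subset_measure0 _ _ (sub _ _) AB); apply: measurableD => //;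
    exact: mI.
- by apply: (subset_measure0 _ _ (sub _ _) BA); apply: measurableD => //;
    exact: mI.
Qed.

Lemma measurable_ballR x r : measurable (ball x r : set (measurableTypeR R)).
Proof. exact: measurable_ball. Qed.

Lemma ess_boundary_mod_null A B : measurable A -> measurable B ->
  eq_mod_null A B -> ess_boundary A = ess_boundary B.
Proof.
move=> mA mB AB; have hd x d : has_density A x d = has_density B x d.
  by rewrite /has_density; under eq_fun do
    rewrite (eq_mod_null_setI mA mB (measurable_ballR _ _) AB).
by apply/seteqP; split=> x; rewrite /ess_boundary /= !hd.
Qed.

Lemma setI_ball_lty E x r : measurable E -> (lam (E `&` ball x r) < +oo)%E.
Proof.
move=> mE; have [r0|r0] := leP r 0;
  first by rewrite (ball0 _ _).2// setI0 measure0.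
apply: (@le_lt_trans _ _ (lam (ball x r)));
  last by rewrite lebesgue_measure_ball ?ltW// ltry.
apply: le_measure; rewrite ?inE//; first by apply: measurableI => //;
  exact: measurable_ballR.
exact: measurable_ballR.
Qed.

(** For [r > 0] the ball has length [2 * r] and all measures are finite, so the density becomes a
    limit of real quotients. *)
Lemma has_densityP E x d : measurable E ->
  has_density E x d <->
  fine (lam (E `&` ball x r)) / (r *+ 2) @[r --> 0^'+] --> d.
Proof.
move=> mE; rewrite /has_density.
have eqE : \forall r \near 0^'+,
    (lam (E `&` ball x r) * (lam (ball x r))^-1)%E =
    (fine (lam (E `&` ball x r)) / (r *+ 2))%:E.
  near=> r; have r0 : 0 < r by near: r; exact: nbhs_right_gt.
  rewrite lebesgue_measure_ball ?ltW// inver mulrn_eq0/= (gt_eqF r0)// EFinM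
    fineK//.
  by rewrite ge0_fin_numE// setI_ball_lty.
split=> h.
  apply/(@fine_cvg _ _ _ _
    (fun r => (fine (lam (E `&` ball x r)) / (r *+ 2))%:E)).
  by apply: cvg_trans h; apply: near_eq_cvg; apply: filterS eqE => r ->.
suff : (fine (lam (E `&` ball x r)) / (r *+ 2))%:E @[r --> 0^'+] --> d%:E.
  move=> {}h; apply: cvg_trans h; apply: near_eq_cvg.
  by apply: filterS eqE => r ->.
by apply: cvg_EFin => //; near=> r.
Unshelve. all: by end_near. Qed.

Lemma measure_ball_setC E x r : measurable E -> 0 < r ->
  fine (lam (~` E `&` ball x r)) = r *+ 2 - fine (lam (E `&` ball x r)).
Proof.
move=> mE r0; apply/eqP; rewrite eq_sym subr_eq -[eqbLHS]/(fine (r *+ 2)%:E).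
rewrite -(@lebesgue_measure_ball _ x) ?ltW//.
rewrite -fineD ?ge0_fin_numE ?setI_ball_lty//; last exact: measurableC.
rewrite -measureU; first by rewrite -setIUl setvU setTI.
- by apply: measurableI; [exact: measurableC|exact: measurable_ballR].
- by apply: measurableI => //; exact: measurable_ballR.
- by rewrite setIACA setICl set0I.
Qed.

Lemma has_density_setC E x d : measurable E ->
  has_density E x d -> has_density (~` E) x (1 - d).
Proof.
move=> mE /(has_densityP _ _ mE) h; apply/has_densityP;
  first exact: measurableC.
have {}h : 1 - fine (lam (E `&` ball x r)) / (r *+ 2) @[r --> 0^'+] --> 1 - d.
  by apply: cvgB => //; exact: cvg_cst.
apply: cvg_trans h; apply: near_eq_cvg; near=> r.
have r0 : 0 < r by near: r; exact: nbhs_right_gt.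
by rewrite /= measure_ball_setC// mulrBl divff// mulrn_eq0/= gt_eqF.
Unshelve. all: by end_near. Qed.

Lemma ess_boundary_setC E :
  measurable E -> ess_boundary (~` E) = ess_boundary E.
Proof.
move=> mE; apply/seteqP; split=> x [h0 h1]; split => h.
- by apply: h1; rewrite -(subr0 1); exact: has_density_setC.
- by apply: h0; rewrite -(subrr 1); exact: has_density_setC.
- by apply: h1; rewrite -(subr0 1) -(setCK E); apply: has_density_setC => //;
    exact: measurableC.
- by apply: h0; rewrite -(subrr 1) -(setCK E); apply: has_density_setC => //;
    exact: measurableC.
Qed.

Lemma null_notin_ess_boundary E x e : measurable E -> 0 < e ->
  lam (E `&` ball x e) = 0%E -> ~ ess_boundary E x.
Proof.
move=> mE e0 null [+ _]; apply; apply/has_densityP => //.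
apply: cvg_near_cst; near=> r.
rewrite (_ : lam (E `&` ball x r) = 0%E) ?mul0r//.
apply: (subset_measure0 _ _ _ null).
- by apply: measurableI => //; exact: measurable_ballR.
- by apply: measurableI => //; exact: measurable_ballR.
- apply: setIS; apply: le_ball; near: r; exact: nbhs_right_le.
Unshelve. all: by end_near. Qed.

(** Up to null sets, [E] fills exactly the right half of every small ball at [c], so its density
    there is 1/2. *)
Lemma half_ess_boundary E c e : measurable E -> 0 < e ->
  lam (E `&` `]c - e, c[) = 0%E -> lam (`]c, c + e[ `\` E) = 0%E ->
  ess_boundary E c.
Proof.
move=> mE e0 nul ful.
have ratio :
    fine (lam (E `&` ball c r)) / (r *+ 2) @[r --> 0^'+] --> (2^-1 : R).
  apply: cvg_near_cst; near=> r.
  have r0 : 0 < r by near: r; exact: nbhs_right_gt.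
  have re : r <= e by near: r; exact: nbhs_right_le.
  have lamr : lam `]c, c + r[%classic = r%:E.
    by rewrite lebesgue_measure_itv/= lte_fin ltrDl r0 -EFinD addrC addKr.
  have mEb : measurable (E `&` ball c r).
    by apply: measurableI => //; exact: measurable_ballR.
  suff -> : lam (E `&` ball c r) = r%:E by rewrite /=; field; lra.
  apply/eqP; rewrite eq_le -lamr; apply/andP; split;
    apply: le_measure_mod_null => //.
    have mEc : measurable (E `&` `]c - e, c[ : set (measurableTypeR R)).
      exact: measurableI.
    have nul' : lam ([set c] `|` (E `&` `]c - e, c[)) = 0%E.
      apply/eqP; rewrite -measure_le0 -[leRHS]adde0.
      rewrite -[X in (X + _)%E](lebesgue_measure_set1 c) -[X in (_ + X)%E]nul.
      exact: measureU2.
    apply: (subset_measure0 _ _ _ nul');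
      [exact: measurableD|exact: measurableU|].
    move=> x [[Ex]]; rewrite ball_itv /= !in_itv/= => /andP[h1 h2] /negP.
    by have [xc _| |->] := ltgtP x c; [right; split => //; lra|rewrite h2|left].
  apply: (subset_measure0 _ _ _ ful); try exact: measurableD.
  move=> x /= [+ nE]; rewrite !in_itv/= => /andP[h1 h2]; split; first lra.
  by move=> Ex; apply: nE; split => //; rewrite ball_itv/= in_itv/=; lra.
by split=> /(has_densityP _ _ mE) h;
  [have : (2^-1 : R) = 0|have : (2^-1 : R) = 1];
    (exact: (norm_cvg_unique ratio h)) || lra.
Unshelve. all: by end_near. Qed.

End essential_boundary.

(** * Intervals free of essential boundary points; reflection *)

Section locally_constant.
Context {R : realType}.
Local Notation lam := (@lebesgue_measure R).
Implicit Types (E A B : set (measurableTypeR R)) (a b x y u v : R).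

(** To the right of [a], a primitive of the indicator function of [E]. *)
Let G E a x := fine (lam (E `&` `]a, x])).

Let mIoc E u v : measurable E ->
  measurable (E `&` `]u, v] : set (measurableTypeR R)).
Proof. by move=> mE; exact: measurableI. Qed.

Let Ioc_le E u v : measurable E ->
  (lam (E `&` `]u, v]) <= (Num.max 0 (v - u))%:E)%E.
Proof.
move=> mE; apply: (@le_trans _ _ (lam `]u, v]%classic)).
  by apply: le_measure; rewrite ?inE//; exact: mIoc.
rewrite lebesgue_measure_itv/= lte_fin; case: ifPn => uv.
  by rewrite -EFinD lee_fin le_max lexx orbT.
by rewrite lee_fin le_max lexx.
Qed.

Let Ioc_fin E u v : measurable E -> lam (E `&` `]u, v]) \is a fin_num.
Proof.
by move=> mE; rewrite ge0_fin_numE// (le_lt_trans (Ioc_le _ _ mE))// ltry.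
Qed.

Let G_incr E a u v : measurable E -> u <= v ->
  G E a u <= G E a v <= G E a u + fine (lam (E `&` `]u, v])).
Proof.
move=> mE uv; rewrite /G -fineD ?Ioc_fin// !fine_le ?fin_numD ?Ioc_fin//.
  rewrite (le_trans _ (measureU2 _ _ _))//; try exact: mIoc.
  apply: le_measure; rewrite ?inE//; first exact: mIoc.
    by apply: measurableU; exact: mIoc.
  move=> x [Ex]/=; rewrite !in_itv/= => /andP[h1 h2].
  by have [xu|ux] := leP x u; [left|right]; split => //=; rewrite h1.
apply: le_measure; rewrite ?inE//; try exact: mIoc.
move=> x [Ex]/=; rewrite !in_itv/= => /andP[h1 h2].
by split => //=; rewrite h1 (le_trans h2).
Qed.

(** The increment is the measure of the part of [E] between [x] and [y]. The radius is doubled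
    because balls are open and the end point [y] must be covered. *)
Let G_dist E a x y : measurable E -> x != y ->
  `|G E a y - G E a x| <= fine (lam (E `&` ball x (2 * `|y - x|))).
Proof.
move=> mE xy.
have le_ball u v : (forall z, u < z <= v -> `|x - z| < 2 * `|y - x|) ->
    fine (lam (E `&` `]u, v])) <= fine (lam (E `&` ball x (2 * `|y - x|))).
  move=> uvb; apply: fine_le; rewrite ?Ioc_fin//.
    by rewrite ge0_fin_numE// setI_ball_lty.
  apply: le_measure; rewrite ?inE//; first exact: mIoc.
    by apply: measurableI => //; exact: measurable_ballR.
  by apply: setIS => z; rewrite /= in_itv/= => /uvb.
have [xy'|yx|] := ltgtP x y; last by move=> e; rewrite e eqxx in xy.
- have /andP[h1 h2] := G_incr a mE (ltW xy').
  rewrite ger0_norm ?subr_ge0// lerBlDl (le_trans h2)// lerD2l le_ball//.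
  move=> z /andP[z1 z2].
  by rewrite ltr_norml (gtr0_norm (_ : 0 < y - x)); lra.
- have /andP[h1 h2] := G_incr a mE (ltW yx).
  rewrite ler0_norm ?subr_le0// opprB lerBlDl (le_trans h2)// lerD2l le_ball//.
  move=> z /andP[z1 z2].
  by rewrite ltr_norml (ltr0_norm (_ : y - x < 0)); lra.
Qed.

Let G_continuous E a : measurable E -> continuous (G E a).
Proof.
move=> mE x; apply/cvgrPdist_le => e e0; near=> y.
have [->|xy] := eqVneq x y; first by rewrite subrr normr0 ltW.
rewrite distrC (le_trans (G_dist a mE xy))//
  (@le_trans _ _ (2 * `|y - x| *+ 2))//.
  rewrite -[leRHS]/(fine (2 * `|y - x| *+ 2)%:E) -(@lebesgue_measure_ball _ x)
    ?mulr_ge0//.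
  apply: fine_le; rewrite ?ge0_fin_numE ?setI_ball_lty//.
    by rewrite lebesgue_measure_ball ?mulr_ge0// ltry.
  apply: le_measure; rewrite ?inE//; last exact: measurable_ballR.
  by apply: measurableI => //; exact: measurable_ballR.
suff : `|y - x| < e / 4 by lra.
rewrite distrC; near: y; apply: (@cvgr_dist_lt _ _ _ (nbhs x) _ id) => //; lra.
Unshelve. all: by end_near. Qed.

(** By [G_dist], a difference quotient of step [h] is at most 4 times the density quotient at radius
    [2 * |h|], whence the bounds [e / 4] and [d / 2]. *)
Let G_derive0 E a x : measurable E -> has_density E x 0 ->
  is_derive x 1 (G E a) 0.
Proof.
move=> mE /(has_densityP _ _ mE) dens.
suff cv :
    h^-1 *: (G E a (h *: (1:R) + x) - G E a x) @[h --> (0:R)^'] --> (0 : R).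
  apply: DeriveDef; first exact: (cvgP _ cv).
  exact: (cvg_lim _ cv).
apply/cvgrPdist_lt => e e0.
move/cvgrPdist_lt : dens => /(_ (e / 4) ltac:(lra))[d /= d0 hd].
exists (d / 2) => /=; first lra.
move=> h; rewrite /ball_/= sub0r normrN => hd2 h0.
have nh : 0 < `|h| by rewrite normr_gt0.
have := hd (2 * `|h|); rewrite /ball_/= !sub0r !normrN.
rewrite (ger0_norm (_ : 0 <= 2 * `|h|)) ?mulr_ge0//.
move=> /(_ ltac:(lra) ltac:(lra)).
set m := lam _ => hm.
have mge : 0 <= fine m by apply: fine_ge0; exact: measure_ge0.
rewrite ger0_norm in hm; last by rewrite divr_ge0// mulrn_wge0// mulr_ge0.
rewrite normrZ normfV ltr_pdivrMl//.
have := @G_dist E a x (h *: (1:R) + x) mE.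
rewrite addrK [h *: _]mulr1 -/m => /(_ _)/le_lt_trans; apply.
  by rewrite eq_sym -subr_eq0 addrK.
by move: hm; rewrite ltr_pdivrMr; lra.
Qed.

Let G_setC E a x : measurable E -> a <= x -> G E a x + G (~` E) a x = x - a.
Proof.
move=> mE; rewrite le_eqVlt => /predU1P[->|ax].
  by rewrite /G set_itvoc0 !setI0 measure0 subrr addr0.
rewrite /G -fineD ?Ioc_fin//; last exact: measurableC.
have mEC : measurable (~` E) by exact: measurableC.
have := @measureU _ _ _ lam _ _ (mIoc a x mE) (mIoc a x mEC).
rewrite setIACA setICr set0I => /(_ erefl) <-.
rewrite -setIUl setUv setTI /=.
by rewrite lebesgue_measure_itv/= lte_fin ax.
Qed.

(** The complement has density 0 at [x], and the two primitives add up to [y - a] for [y >= a],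
    hence near [x]. *)
Let G_derive1 E a x : measurable E -> a < x -> has_density E x 1 ->
  is_derive x 1 (G E a) 1.
Proof.
move=> mE ax /(has_density_setC mE); rewrite subrr => d0.
have dC := G_derive0 a (measurableC mE) d0.
have : is_derive x 1 (((id : R -> R) - cst a) - G (~` E) a) 1.
  by apply: is_derive_eq; rewrite !subr0.
apply: near_eq_is_derive; near=> y.
have ay : a <= y by near: y; exact: lt_le_nbhsr.
change (y - a - G (~` E) a y = G E a y).
by rewrite -(G_setC mE ay) addrK.
Unshelve. all: by end_near. Qed.

(* [G E a] has derivative 0 or 1 at each point of []a, b[], according to the
   density of [E] there, so the mean value theorem gives [lam (E `&` ]a, b])] in
   [{0, b - a}]. *)
Lemma ess_boundary_dichotomy E a b : measurable E -> a < b ->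
  (forall x, a < x < b -> ~ ess_boundary E x) ->
  lam (E `&` `]a, b[) = 0%E \/ lam (`]a, b[ `\` E) = 0%E.
Proof.
move=> mE ab nbd.
pose df x := if `[< has_density E x 0 >] then 0 : R else 1.
have [x||c _] := @MVT _ (G E a) df a b ab.
- rewrite in_itv/= => /andP[ax xb]; rewrite /df; case: asboolP => d0.
    exact: G_derive0.
  apply: G_derive1 => //; apply: contrapT => d1.
  by apply: (nbd x); rewrite ?ax.
- by apply: continuous_subspaceT; exact: G_continuous.
rewrite {2}/G set_itvoc0 setI0 measure0 subr0 => Gb.
have Eoo : lam (E `&` `]a, b[) = lam (E `&` `]a, b]).
  apply/eqP; rewrite eq_le; apply/andP; split.
    apply: le_measure; rewrite ?inE//; [exact: measurableI|exact: mIoc|].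
    by apply: setIS; exact: subset_itv_oo_oc.
  apply: le_measure_mod_null; [exact: mIoc|exact: measurableI|].
  apply: (subset_measure0 _ _ _ (lebesgue_measure_set1 b)) => //.
    by apply: measurableD; [exact: mIoc|exact: measurableI].
  move=> x [[Ex]]; rewrite /= !in_itv/= => /andP[-> xb] nE.
  by apply: contrapT => /eqP xneb; apply: nE; split => //=;
    rewrite lt_neqAle xneb.
have Gfin : lam (E `&` `]a, b]) = (G E a b)%:E by rewrite fineK// Ioc_fin.
move: Gb; rewrite /df; case: ifPn => _; rewrite ?mul0r ?mul1r => Gb.
  by left; rewrite Eoo Gfin Gb.
right; apply/eqP; rewrite -measure_le0 -(@leeD2lE _ (lam (E `&` `]a, b[)));
  last first.
  by rewrite Eoo Gfin.
rewrite adde0 -measureU//; last first.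
- by apply/seteqP; split => // x [[Ex _] [_]].
- exact: measurableD.
- exact: measurableI.
rewrite Eoo Gfin Gb setIC setUIDK/=.
by rewrite lebesgue_measure_itv/= lte_fin ab.
Qed.

Lemma measurable_preimage_oppr E : measurable E ->
  measurable (-%R @^-1` E : set (measurableTypeR R)).
Proof.
move=> mE; rewrite -[X in measurable X]setTI.
exact: (@oppr_measurable R setT measurableT _ mE).
Qed.

Lemma has_density_oppr E x d : measurable E ->
  has_density (-%R @^-1` E) x d <-> has_density E (- x) d.
Proof.
move=> mE; rewrite /has_density.
rewrite (_ : (fun r => _) =
  (fun r => (lam (E `&` ball (- x)%R r) / lam (ball (- x)%R r)))%E)//.
apply/funext => r.
have ballN : -%R @^-1` (ball (- x) r) = ball x r :> set R.
  by apply/seteqP; split=> y; rewrite /ball/= -opprD normrN.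
rewrite -ballN -preimage_setI.
have mb := measurable_ballR (- x) r.
rewrite -[in RHS](lebesgue_measureN (measurableI _ _ mE mb)).
by rewrite -[in RHS](lebesgue_measureN mb).
Qed.

Lemma ess_boundary_oppr E x : measurable E ->
  ess_boundary (-%R @^-1` E) x <-> ess_boundary E (- x).
Proof. by move=> mE; rewrite /ess_boundary/= !has_density_oppr. Qed.

End locally_constant.

(** * Log-convex densities *)

Section density.
Context {R : realType} (mu : probability (measurableTypeR R) R)
  (f : R -> \bar R).
Context (hmu : log_convex_class mu f).
Local Notation lam := (@lebesgue_measure R).
Implicit Types (A B E : set (measurableTypeR R)) (x y b u : R).

Lemma prob_fin_num A : measurable A -> mu A \is a fin_num.
Proof. by move=> mA; exact: fin_num_measure. Qed.

(** The density is positive off the origin, and the origin is itself Lebesgue-null. *)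
Lemma lcf_null A : measurable A -> mu A = 0%E <-> lam A = 0%E.
Proof.
move=> mA.
have mf : measurable_fun A f by apply: measurable_funS (lcf_meas hmu).
have abs_int : mu A = (\int[lam]_(x in A) `|f x|)%E.
  by rewrite (lcf_density hmu)//; apply: eq_integral => x _;
    rewrite gee0_abs// (lcf_ge0 hmu).
rewrite abs_int (ae_eq_integral_abs _ _ _) //; split=> [[N [mN N0 sub]]|A0].
  apply: (@subset_measure0 _ _ _ _ _ (N `|` [set 0])) => //;
    first exact: measurableU.
    move=> x Ax; have [->|x0] := eqVneq x 0; first by right.
    left; apply: sub => /= /(_ Ax) fx0.
    by have /andP[] := lcf_pos_fin hmu x0; rewrite fx0 ltxx.
  apply/eqP; rewrite -measure_le0 -[leRHS]adde0 -[X in (X + _)%E]N0.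
  by rewrite -[X in (_ + X)%E](lebesgue_measure_set1 0); exact: measureU2.
by exists A; split => // x /=; apply: contra_notP => nA Ax; case: nA.
Qed.

Lemma lcf_EFin x : x != 0 -> f x = (fine (f x))%:E.
Proof.
by move=> /(lcf_pos_fin hmu)/andP[? ?]; rewrite fineK// gt0_fin_numE.
Qed.

Lemma lcf_gt0 x : x != 0 -> 0 < fine (f x).
Proof. by move=> /(lcf_pos_fin hmu) h; rewrite fine_gt0. Qed.

Lemma lcf_mass_ge c x y : x < y -> 0 <= c ->
  (forall u, x < u < y -> (c%:E <= f u)%E) ->
  c * (y - x) <= fine (mu `]x, y[%classic).
Proof.
move=> xy c0 cf.
have -> : c * (y - x) = fine (\int[lam]_(u in `]x, y[) (cst c%:E) u)%E.
  by rewrite integral_cst//= lebesgue_measure_itv/= lte_fin xy -EFinD -EFinM.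
have le : (\int[lam]_(u in `]x, y[) (cst c%:E) u <= mu `]x, y[%classic)%E.
  rewrite (lcf_density hmu)//; apply: ge0_le_integral => //=.
  by apply: measurable_funS (lcf_meas hmu).
apply: fine_le => //; last exact: prob_fin_num.
by rewrite integral_cst//= lebesgue_measure_itv/= lte_fin xy -EFinD -EFinM.
Qed.

Lemma lcf_mass_le c x y : x < y -> 0 <= c ->
  (forall u, x < u < y -> (f u <= c%:E)%E) ->
  fine (mu `]x, y[%classic) <= c * (y - x).
Proof.
move=> xy c0 cf.
have int_cst : (\int[lam]_(u in `]x, y[) (cst c%:E) u)%E = (c * (y - x))%:E.
  by rewrite integral_cst//= lebesgue_measure_itv/= lte_fin xy -EFinD -EFinM.
rewrite -[leRHS]/(fine (c * (y - x))%:E) -int_cst fine_le ?prob_fin_num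
  ?int_cst//.
rewrite -int_cst (lcf_density hmu)//; apply: ge0_le_integral => //= [u _|];
  first exact: (lcf_ge0 hmu).
by apply: measurable_funS (lcf_meas hmu).
Qed.

Lemma prob_le1 A : measurable A -> fine (mu A) <= 1.
Proof.
move=> mA.
by rewrite -[leRHS]/(fine 1%:E) fine_le ?prob_fin_num// probability_le1.
Qed.

(** These bounds are exponentials of the support line of [ln f] at [b], of slope [- k], and of the
    slope bound to the left of [b]. The last one says that [f x * expR (k * x)] is nonincreasing on
    []0, b]]. *)
Lemma lcf_support b : 0 < b -> exists2 k, 0 < k &
  [/\ forall x, 0 < x -> fine (f b) * expR (- k * (x - b)) <= fine (f x),
      forall x, 0 < x -> x != b ->
        fine (f b) * expR (- k * (x - b)) < fine (f x)
    & forall x u, 0 < x -> x <= u -> u <= b ->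
        fine (f u) * expR (k * (u - x)) <= fine (f x)].
Proof.
move=> b0.
have [s sup] := strictly_convex_support (lcf_convex_pos hmu) b0.
pose phi x := fine (f x).
have phiE x : 0 < x -> phi x = expR (ln (phi x)).
  by move=> x0; rewrite lnK// posrE lcf_gt0// gt_eqF.
have strict x : 0 < x -> x != b -> phi b * expR (s * (x - b)) < phi x.
  by move=> x0 xb; rewrite (phiE b)// -expRD [ltRHS]phiE// ltr_expR sup.
have weak x : 0 < x -> phi b * expR (s * (x - b)) <= phi x.
  move=> x0; have [->|xb] := eqVneq x b;
    first by rewrite subrr mulr0 expR0 mulr1.
  exact/ltW/strict.
have phib0 : 0 < phi b by rewrite lcf_gt0// gt_eqF.
have s0 : s < 0.
  (* If [s >= 0], then [f >= f b] to the right of [b], and an interval of length [2 / f b] would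
     have mass at least 2. *)
  rewrite ltNge; apply/negP => s0.
  have := @lcf_mass_ge (phi b) b (b + 2 / phi b).
  rewrite (_ : phi b * _ = 2); last by field; rewrite gt_eqF.
  rewrite ltrDl divr_gt0// => /(_ isT (ltW phib0)) h.
  suff : 2 <= fine (mu `]b, b + 2 / phi b[%classic).
    by apply/negP; rewrite -ltNge (le_lt_trans (prob_le1 _))// ltr1n.
  apply: h => u /andP[bu _].
  rewrite (lcf_EFin (_ : u != 0)) ?lee_fin;
    last by rewrite gt_eqF// (lt_trans b0).
  apply: le_trans (weak u (lt_trans b0 bu)).
  rewrite ler_peMr ?(ltW phib0)// -expR0 ler_expR.
  by rewrite mulr_ge0// subr_ge0 ltW.
exists (- s); first by rewrite oppr_gt0.
rewrite opprK; split => // x u x0 xu ub.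
have u0 : 0 < u by exact: lt_le_trans xu.
have h := strictly_convex_subline (lcf_convex_pos hmu) sup x0 xu ub.
by rewrite -/(phi u) -/(phi x) (phiE u)// (phiE x)// -expRD ler_expR mulNr.
Qed.

Lemma lcf_decreasing x y : 0 < x -> x < y -> fine (f y) < fine (f x).
Proof.
move=> x0 xy; have [k k0 [_ + _]] := lcf_support (lt_trans x0 xy).
move=> /(_ x x0); rewrite lt_eqF// => /(_ isT); apply: le_lt_trans.
rewrite ler_peMr//; first by rewrite ltW// lcf_gt0// gt_eqF// (lt_trans x0).
by rewrite -expR0 ler_expR; nra.
Qed.

End density.

(** The limit [d -> 0] in the form used below to compare densities pointwise and to reach the
    origin. *)
Lemma le_of_expR_decay (R : realType) (A B k d0 : R) :
  0 < A -> 0 < k -> 0 < d0 ->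
  (forall d, 0 < d < d0 -> A * expR (- (k * d)) <= B) -> A <= B.
Proof.
move=> A0 k0 d00 AB; rewrite leNgt; apply/negP => BA.
(* This makes [A * k * d] at most half the gap [A - B], so that [1 - k * d <= expR (- (k * d))]
   contradicts the hypothesis. *)
pose d := Num.min (d0 / 2) ((A - B) / (2 * k * A)).
have d_gt0 : 0 < d by rewrite lt_min !divr_gt0// ?subr_gt0// !mulr_gt0.
have dd0 : d < d0 by rewrite gt_min; apply/orP; left; lra.
have := AB d; rewrite d_gt0 dd0 => /(_ isT); apply/negP; rewrite -ltNge.
have dle : d * (2 * k * A) <= A - B.
  by rewrite -ler_pdivlMr ?mulr_gt0// ge_min lexx orbT.
have := expR_ge1Dx (- (k * d)).
rewrite -(@ler_pM2l _ A)// => h; apply: lt_le_trans h; lra.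
Qed.

Lemma integral_expR_decay (R : realType) (A k a b : R) : 0 < k -> a < b ->
  (\int[@lebesgue_measure R]_(u in `[a, b]) (A * expR (- k * (u - a)))%:E)%E =
  (A * (1 - expR (- k * (b - a))) / k)%:E.
Proof.
move=> k0 ab.
pose F u := - (A / k) * expR (- k * (u - a)).
have dF (u : R) : is_derive u (1 : R) F (A * expR (- k * (u - a))).
  rewrite /F; apply: is_derive_eq.
  by rewrite /GRing.scale/= subr0; field; lra.
rewrite (@continuous_FTC2 _ (fun u => A * expR (- k * (u - a))) F)//.
- by rewrite /F subrr mulr0 expR0 -EFinD; congr EFin; field; lra.
- apply: continuous_subspaceT => u; apply: differentiable_continuous.
  by apply/derivable1_diffP.
- split.
  + by move=> u _; have [] := dF u.
  + apply: cvg_at_right_filter; apply: differentiable_continuous.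
    by apply/derivable1_diffP; have [] := dF a.
  + apply: cvg_at_left_filter; apply: differentiable_continuous.
    by apply/derivable1_diffP; have [] := dF b.
- by move=> u _; rewrite derive1E; have [_ ->] := dF u.
Qed.

(** * Evenness of the density and its decrease away from the origin *)

Section log_convex_class_theory.
Context {R : realType} (mu : probability (measurableTypeR R) R).
Local Notation lam := (@lebesgue_measure R).
Implicit Types (f : R -> \bar R) (A B E : set (measurableTypeR R))
  (x y b u : R).

Lemma preimage_opprK (A : set R) : -%R @^-1` (-%R @^-1` A) = A.
Proof. by apply/seteqP; split=> x /=; rewrite opprK. Qed.

(** Lebesgue measure and [mu] are both invariant under reflection, so the reflected function is
    again a density of [mu]; the two half-lines exchange their convexity conditions. *)
Lemma log_convex_class_oppr f : log_convex_class mu f ->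
  log_convex_class mu (fun x => f (- x)).
Proof.
case=> noat fge0 mf dens sym pf cn cp c0 infs sups.
have meas : measurable_fun [set: R] (fun x => f (- x)).
  exact: (measurableT_comp mf (@oppr_measurable R setT)).
have conv (D D' : set R) : (forall x, D' x -> D (- x)) ->
    strictly_convex_on D (fun x => ln (fine (f x))) ->
    strictly_convex_on D' (fun x => ln (fine (f (- x)))).
  move=> DD' cD x y t Dx Dy xy t01.
  have := cD (- x) (- y) t (DD' _ Dx) (DD' _ Dy).
  by rewrite eqr_opp !mulrN -opprD => /(_ xy t01).
split => //.
- move=> A mA; have mNA := measurable_preimage_oppr mA.
  rewrite -sym// (dens _ mNA).
  transitivity (
    \int[pushforward lam (-%R : measurableTypeR R -> measurableTypeR R)]_(x in
      -%R @^-1` A) f x)%E.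
    by apply: eq_measure_integral => B mB _; rewrite /= lebesgue_measureN.
  rewrite ge0_integral_pushforward//; last exact: measurable_funS mf.
  by rewrite preimage_opprK.
- by move=> x x0; apply: pf; rewrite oppr_eq0.
- by apply: conv cp => x; rewrite /= !in_itv/= andbT oppr_gt0.
- by apply: conv cn => x; rewrite /= !in_itv/= andbT oppr_lt0.
- apply: (@continuous_comp _ _ _ (-%R : R -> R) f); first exact: opp_continuous.
  by rewrite /= oppr0.
Qed.

(* Applied to [f] and [fun x => f (- x)], two densities of the symmetric measure
   [mu], this yields the evenness of [f]; being pointwise, it needs the continuity
   of the densities, here in the form of the support inequality. *)
Let lcf_uniq_le f1 f2 x : log_convex_class mu f1 -> log_convex_class mu f2 ->
  0 < x -> fine (f1 x) <= fine (f2 x).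
Proof.
move=> h1 h2 x0.
have [k k0 [sup _ _]] := lcf_support h1 x0.
apply: (@le_of_expR_decay _ _ _ k 1) => //;
  first by rewrite (lcf_gt0 h1)// gt_eqF.
move=> d /andP[d0 _].
have xd : x < x + d by rewrite ltrDl.
apply: (@le_trans _ _ (fine (f1 (x + d)))).
  apply: le_trans (sup (x + d) _); last lra.
  by rewrite addrC addKr mulNr.
have dd : x + d - x = d by ring.
(* Both densities decrease and give []x, x + d[] the same mass, which lies between [f1 (x + d) * d]
   and [f2 x * d]. *)
have m1 := @lcf_mass_ge _ _ _ h1 (fine (f1 (x + d))) x (x + d) xd.
have m2 := @lcf_mass_le _ _ _ h2 (fine (f2 x)) x (x + d) xd.
rewrite dd in m1 m2; rewrite -(ler_pM2r d0); apply: le_trans (m1 _ _) (m2 _ _).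
- by apply: ltW; rewrite (lcf_gt0 h1)// gt_eqF//; lra.
- move=> u /andP[xu ud]; rewrite (lcf_EFin h1 (_ : u != 0)) ?lee_fin;
    last by rewrite gt_eqF//; lra.
  by apply: ltW; apply: (lcf_decreasing h1) => //; lra.
- by apply: ltW; rewrite (lcf_gt0 h2)// gt_eqF//; lra.
- move=> u /andP[xu ud]; rewrite (lcf_EFin h2 (_ : u != 0)) ?lee_fin;
    last by rewrite gt_eqF//; lra.
  by apply: ltW; apply: (lcf_decreasing h2) => //; lra.
Qed.

Context (f : R -> \bar R) (hmu : log_convex_class mu f).

Lemma lcf_even x : f (- x) = f x.
Proof.
wlog x0 : x / 0 < x => [th|].
  have [x0|x0|->] := ltgtP x 0; [|exact: th|by rewrite oppr0].
  by rewrite -[in RHS](opprK x) [RHS]th// oppr_gt0.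
have hmuN := log_convex_class_oppr hmu.
rewrite (lcf_EFin hmu) ?oppr_eq0 ?gt_eqF// (lcf_EFin hmu (lt0r_neq0 x0)).
congr EFin; apply/eqP; rewrite eq_le (lcf_uniq_le hmu hmuN x0) andbT.
exact: (lcf_uniq_le hmuN hmu x0).
Qed.

(** By continuity [f 0] is the limit, possibly infinite, of [f y] as [y] decreases to 0, and
    [f y > f x] once [0 < y < x]. *)
Lemma lcf_le0 x : (f x <= f 0)%E.
Proof.
wlog x0 : x / 0 < x => [th|].
  have [x0|x0|->//] := ltgtP x 0; last exact: th.
  by rewrite -lcf_even th// oppr_gt0.
have c0 : f y @[y --> 0^'+] --> f 0.
  by apply: cvg_at_right_filter; exact: (lcf_cont0 hmu).
apply: cvge_to_ge c0 _; near=> y.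
have y0 : 0 < y by near: y; exact: nbhs_right_gt.
rewrite (lcf_EFin hmu (lt0r_neq0 x0)) (lcf_EFin hmu (lt0r_neq0 y0)) lee_fin
  ltW//.
apply: (lcf_decreasing hmu) => //; near: y; exact: nbhs_right_lt.
Unshelve. all: by end_near. Qed.

Lemma lcf_lt x b : `|x| < b -> (f b < f x)%E.
Proof.
move=> xb; have b0 : 0 < b by rewrite (le_lt_trans _ xb).
have -> : f x = f `|x|.
  by have [x0|x0] := leP 0 x; [rewrite ger0_norm|rewrite ltr0_norm ?lcf_even].
have lt y : 0 < y -> y < b -> (f b < f y)%E.
  move=> y0 yb.
  rewrite (lcf_EFin hmu (lt0r_neq0 b0)) (lcf_EFin hmu (lt0r_neq0 y0)).
  by rewrite lte_fin (lcf_decreasing hmu).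
have := normr_ge0 x; rewrite le_eqVlt => /predU1P[<-|/lt]; last exact.
by apply: lt_le_trans (lcf_le0 (b / 2)); apply: lt; lra.
Qed.

End log_convex_class_theory.

(** * Comparison of density increments with tail increments *)

Section tail.
Context {R : realType} (mu : probability (measurableTypeR R) R)
  (f : R -> \bar R).
Context (hmu : log_convex_class mu f).
Local Notation lam := (@lebesgue_measure R).
Implicit Types (A B E : set (measurableTypeR R)) (x y b c u : R).

Definition tail x := fine (mu `]x, +oo[%classic).

Lemma prob_setU A B : measurable A -> measurable B -> A `&` B = set0 ->
  fine (mu (A `|` B)) = fine (mu A) + fine (mu B).
Proof. by move=> mA mB AB; rewrite measureU// fineD// prob_fin_num. Qed.

Lemma prob_ge0 A : 0 <= fine (mu A).
Proof. by apply: fine_ge0; exact: measure_ge0. Qed.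

Lemma prob_itv_cc x y : x < y -> fine (mu `[x, y]%classic) = tail x - tail y.
Proof.
move=> xy; apply/eqP; rewrite eq_sym subr_eq; apply/eqP.
transitivity (fine (mu `[x, +oo[%classic)).
  rewrite -(@setU1itv _ _ _ _ false) ?bnd_simp// prob_setU//.
    by rewrite (lcf_no_atoms hmu) add0r.
  by apply/seteqP; split => // z [/= ->]; rewrite in_itv/= ltxx.
rewrite -prob_setU//.
  by rewrite -itv_bndbnd_setU// bnd_simp// ltW.
apply/seteqP; split => // z [/=];
  rewrite !in_itv/= andbT => /andP[_ zy] /(le_lt_trans zy).
by rewrite ltxx.
Qed.

Lemma tail_ltW x y : x < y -> tail y <= tail x.
Proof. by move=> xy; rewrite -subr_ge0 -prob_itv_cc// prob_ge0. Qed.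

Let support_mass_ge b c k : 0 < b -> b < c -> 0 < k ->
  (forall x, 0 < x -> fine (f b) * expR (- k * (x - b)) <= fine (f x)) ->
  fine (f b) * (1 - expR (- k * (c - b))) <= k * (tail b - tail c).
Proof.
move=> b0 bc k0 sup; rewrite -prob_itv_cc// -ler_pdivrMl// mulrC.
rewrite -[leLHS]/(fine (_)%:E) -(integral_expR_decay _ k0 bc); apply: fine_le.
- by rewrite integral_expR_decay.
- exact: prob_fin_num.
rewrite (lcf_density hmu)//; apply: ge0_le_integral => //=.
- by move=> u _; rewrite lee_fin mulr_ge0 ?expR_ge0// fine_ge0// (lcf_ge0 hmu).
- apply/measurable_EFinP;
    apply: measurable_funS (_ : measurable_fun setT _) => //.
  apply: continuous_measurable_fun => u; apply: differentiable_continuous.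
  by apply/derivable1_diffP.
- by apply: measurable_funS (lcf_meas hmu).
- move=> u; rewrite in_itv/= => /andP[bu _].
  have u0 : 0 < u by exact: lt_le_trans bu.
  by rewrite [leRHS](lcf_EFin hmu (lt0r_neq0 u0)) lee_fin sup.
Qed.

Let mass_le_decay x b k v : 0 < k -> x < b -> 0 <= v ->
  (forall u, x <= u -> u <= b -> (f u <= (v * expR (- k * (u - x)))%:E)%E) ->
  k * (tail x - tail b) <= v * (1 - expR (- k * (b - x))).
Proof.
move=> k0 xb v0 fv; rewrite -prob_itv_cc// -ler_pdivlMl// mulrC.
rewrite -[leRHS]/(fine (_)%:E) -(integral_expR_decay _ k0 xb); apply: fine_le.
- exact: prob_fin_num.
- by rewrite integral_expR_decay.
rewrite (lcf_density hmu)//; apply: ge0_le_integral => //=.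
- by move=> u _; exact: (lcf_ge0 hmu).
- by apply: measurable_funS (lcf_meas hmu).
- apply/measurable_EFinP;
    apply: measurable_funS (_ : measurable_fun setT _) => //.
  apply: continuous_measurable_fun => u; apply: differentiable_continuous.
  by apply/derivable1_diffP.
- by move=> u; rewrite in_itv/= => /andP[]; exact: fv.
Qed.

(** One rate [k], that of the support exponential at [b], serves on both sides of [b], so the bounds
    can be added. They come from integrating the exponential bounds over [[b, c]] and [[x, b]]; the
    second one is the limit case of an infinite [c]. Finiteness of [f x] excludes [x = 0] with
    [f 0 = +oo], where [fine] would return 0. *)
Lemma lcf_tail b : 0 < b -> exists2 k, 0 < k & [/\
    forall c, b < c -> fine (f b) - fine (f c) <= k * (tail b - tail c),
    fine (f b) <= k * tail b
  & forall x, 0 <= x -> x < b -> (f x < +oo)%E ->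
      k * (tail x - tail b) < fine (f x) - fine (f b)].
Proof.
move=> b0; have [k k0 [sup strict mono]] := lcf_support hmu b0.
have fb0 : 0 < fine (f b) by apply: (lcf_gt0 hmu); rewrite gt_eqF.
exists k => //; split.
- move=> c bc; have := support_mass_ge b0 bc k0 sup.
  have := sup c (lt_trans b0 bc); lra.
- rewrite leNgt; apply/negP => lt.
  pose D := fine (f b) - k * tail b.
  have D0 : 0 < D by rewrite subr_gt0.
  (* Here [D * (1 + k * d) > f b], so [f b * expR (- k * d) < D], and [[b, b + d]] would have mass
     larger than [tail b]. *)
  pose d := fine (f b) / (D * k).
  have d0 : 0 < d by rewrite divr_gt0// mulr_gt0.
  have := @support_mass_ge b (b + d) k b0; rewrite ltrDl => /(_ d0 k0 sup).
  rewrite [b + d]addrC addrK; apply/negP; rewrite -ltNge.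
  have kd : k * d * D = fine (f b) by rewrite /d; field; lra.
  have e1 : fine (f b) * expR (- k * d) < D.
    rewrite mulNr expRN ltr_pdivrMr ?expR_gt0//.
    have := expR_ge1Dx (k * d); nra.
  apply: (@le_lt_trans _ _ (k * tail b));
    first by rewrite ler_wpM2l ?(ltW k0)// lerBlDr lerDl prob_ge0.
  by rewrite mulrBr mulr1; rewrite /D in e1; lra.
- move=> x x0 xb fxoo.
  have fxE : f x = (fine (f x))%:E.
    by rewrite fineK// ge0_fin_numE// (lcf_ge0 hmu).
  have mono0 u : x <= u -> u <= b -> 0 < u ->
      fine (f u) * expR (k * (u - x)) <= fine (f x).
    (* [f 0] is the supremum of [f], so the case [x = 0] is the limit of the
       bounds at the points [d > 0]. *)
    move=> xu ub u0; move: x0; rewrite le_eqVlt => /predU1P[x0|x0];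
      last exact: mono.
    rewrite -x0 subr0; apply: (@le_of_expR_decay _ _ _ k u) => //.
      by rewrite mulr_gt0 ?expR_gt0// (lcf_gt0 hmu)// gt_eqF.
    move=> d /andP[d0 du]; rewrite -mulrA -expRD -mulrBr.
    apply: (le_trans (mono d u d0 (ltW du) ub)).
    apply: fine_le (lcf_le0 hmu d); last by rewrite x0 fxE.
    by rewrite (lcf_EFin hmu (lt0r_neq0 d0)).
  have := @mass_le_decay x b k (fine (f x)) k0 xb.
  rewrite fine_ge0 ?(lcf_ge0 hmu)// => /(_ isT).
  have m : fine (f b) < fine (f x) * expR (- k * (b - x)).
    (* The strict support bound requires a positive point, so strictness is taken at the midpoint
       [z] and carried to [x] by [mono0], also when [x = 0]. *)
    pose z := (x + b) / 2.
    have z0 : 0 < z by rewrite /z; lra.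
    have := mono0 z; have := strict z z0 _.
    rewrite lt_eqF; last by rewrite /z; lra.
    move=> /(_ isT) h1 /(_ _ _ _) h2.
    have {h2} : fine (f z) * expR (k * (z - x)) <= fine (f x).
      by apply: h2; rewrite /z; lra.
    have {h1} : fine (f b) * expR (- k * (z - b)) < fine (f z) by [].
    have -> : - k * (b - x) = - (k * (z - x)) + - (- k * (z - b)) by ring.
    rewrite expRD !expRN mulrA => h1 h2.
    rewrite ltr_pdivlMr ?expR_gt0// (lt_le_trans h1)// ler_pdivlMr ?expR_gt0//.
  move=> h; apply: le_lt_trans (h _) _; last by move: m; lra.
  move=> u xu ub; move: (x0); rewrite le_eqVlt => /predU1P[x00|x_gt0].
    have [u0|u0] := eqVneq u 0.
      by rewrite u0 -x00 subrr mulr0 expR0 mulr1 x00 fxE.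
    rewrite (lcf_EFin hmu u0) lee_fin mulNr expRN ler_pdivlMr ?expR_gt0//
      mono0//.
    by rewrite lt_neqAle eq_sym u0 x00.
  have u0 : 0 < u by exact: lt_le_trans xu.
  by rewrite [leLHS](lcf_EFin hmu (lt0r_neq0 u0)) lee_fin mulNr expRN
    ler_pdivlMr ?expR_gt0// mono0.
Qed.

End tail.

(** * Two-point inequalities, continuity of the distribution function, quantiles *)

Section quantile.
Context {R : realType} (mu : probability (measurableTypeR R) R)
  (f : R -> \bar R).
Context (hmu : log_convex_class mu f).
Implicit Types (A B E : set (measurableTypeR R)) (x y b c u q : R).

(** With the common [k] of [lcf_tail], [f x - f b > k * (tail x - tail b) >= k * (tail b - tail c)
    >= f b - f c]. *)
Lemma lcf_tail_convex x b c : 0 <= x -> x < b -> b < c ->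
  2 * tail mu b <= tail mu x + tail mu c -> ((2 * fine (f b))%:E < f x + f c)%E.
Proof.
move=> x0 xb bc T; have b0 : 0 < b by lra.
have c0 : 0 < c by lra.
rewrite (lcf_EFin hmu (lt0r_neq0 c0)).
have [fx|] := boolP (f x < +oo)%E; last first.
  by rewrite -leNgt leye_eq => /eqP ->; rewrite addye// ltry.
have [k k0 [hc _ hx]] := lcf_tail hmu b0.
have := hx x x0 xb fx; have := hc c bc.
rewrite -[f x]fineK ?ge0_fin_numE ?(lcf_ge0 hmu)//= -EFinD lte_fin.
by move: (tail mu b) (tail mu x) (tail mu c) T => tb tx tc *; nra.
Qed.

(** The analogue of [lcf_tail_convex] with [c] at infinity, using [f b <= k * tail b]. *)
Lemma lcf_tail_double x b : 0 <= x -> x < b ->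
  2 * tail mu b <= tail mu x -> ((2 * fine (f b))%:E < f x)%E.
Proof.
move=> x0 xb T; have b0 : 0 < b by lra.
have [fx|] := boolP (f x < +oo)%E; last first.
  by rewrite -leNgt leye_eq => /eqP ->; rewrite ltry.
have [k k0 [_ hb hx]] := lcf_tail hmu b0.
have := hx x x0 xb fx.
rewrite -[f x]fineK ?ge0_fin_numE ?(lcf_ge0 hmu)//= lte_fin.
by move: (tail mu b) (tail mu x) T hb => tb tx *; nra.
Qed.

Lemma tailE x : tail mu x = 1 - distr_fun mu x.
Proof.
apply/eqP; rewrite eq_sym subr_eq -prob_setU//.
  by rewrite setUC -itv_bndbnd_setU ?bnd_simp// set_itvNyy probability_setT.
by apply/seteqP; split => // y [/=];
  rewrite !in_itv/= andbT => /lt_le_trans /[apply]; rewrite ltxx.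
Qed.

Lemma mu_itvcy x : mu `[x, +oo[%classic = mu `]x, +oo[%classic.
Proof.
rewrite -(@setU1itv _ _ _ _ false) ?bnd_simp// measureU//=.
  by rewrite (lcf_no_atoms hmu) add0e.
by apply/seteqP; split => // z [/= ->]; rewrite in_itv/= ltxx.
Qed.

Lemma distr_funN x : distr_fun mu (- x) = tail mu x.
Proof.
rewrite /distr_fun /tail -mu_itvcy; congr fine; rewrite -[RHS](lcf_sym hmu)//.
by rewrite opp_preimage_itvbndy.
Qed.

Lemma tailN x : tail mu (- x) = 1 - tail mu x.
Proof. by rewrite tailE distr_funN. Qed.

(** Right continuity holds for every distribution function, and [F x = 1 - F (- x)] turns it into
    left continuity. *)
Lemma distr_fun_continuous : continuous (distr_fun mu).
Proof.
(* [distr_fun mu] is the distribution function of the identity, seen as a random variable. *)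
pose X : measurableTypeR R -> R := idfun.
pose mX := @isMeasurableFun.Build _ _ _ _ X (@measurable_id _ _ setT).
pose RVX : {RV mu >-> R} := HB.pack X mX.
have rc x : distr_fun mu y @[y --> x^'+] --> distr_fun mu x.
  apply: fine_cvg; rewrite fineK; last exact: prob_fin_num.
  exact: (@cdf_right_continuous _ _ _ mu RVX x).
have E x : distr_fun mu x = 1 - distr_fun mu (- x).
  by rewrite distr_funN tailE subKr.
move=> x; apply/left_right_continuousP; split; last exact: rc.
suff : 1 - distr_fun mu (- y) @[y --> x^'-] --> 1 - distr_fun mu (- x).
  by rewrite -E; under eq_fun do rewrite -E.
apply: cvgB; first exact: cvg_cst.
apply/cvg_at_leftNP; rewrite (_ : _ \o _ = distr_fun mu); first exact: rc.
by apply/funext => y; rewrite /= opprK.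
Qed.

Lemma distr_fun_surj q : 0 < q < 1 -> exists x, distr_fun mu x = q.
Proof.
pose X : measurableTypeR R -> R := idfun.
pose mX := @isMeasurableFun.Build _ _ _ _ X (@measurable_id _ _ setT).
pose RVX : {RV mu >-> R} := HB.pack X mX.
move=> /andP[q0 q1].
have [b qb] : exists b, q < distr_fun mu b.
  have h : distr_fun mu x @[x --> +oo] --> (1 : R).
    by apply: fine_cvg; exact: (@cvg_cdfy1 _ _ _ mu RVX).
  by have [b] := filter_ex (cvgr_gt 1 h q q1); exists b.
have [a qa] : exists a, distr_fun mu a < q.
  have h : distr_fun mu x @[x --> -oo] --> (0 : R).
    by apply: fine_cvg; exact: (@cvg_cdfNy0 _ _ _ mu RVX).
  by have [a] := filter_ex (cvgr_lt 0 h q q0); exists a.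
have ab : a <= b.
  rewrite leNgt; apply/negP => ba;
    suff : distr_fun mu b <= distr_fun mu a by lra.
  have := @tail_ltW _ _ _ hmu _ _ ba; rewrite !tailE; lra.
have qab : Num.min (distr_fun mu a) (distr_fun mu b) <= q <=
           Num.max (distr_fun mu a) (distr_fun mu b).
  by rewrite ge_min le_max (ltW qa) (ltW qb) orbT.
have [x _ xq] := IVT ab (continuous_subspaceT distr_fun_continuous) qab.
by exists x.
Qed.

Lemma distr_invE q : 0 < q < 1 ->
  exists2 x, distr_inv mu q = x%:E & distr_fun mu x = q.
Proof.
move=> q01; have [x xq] := distr_fun_surj q01; move: q01 => /andP[q0 q1].
rewrite /distr_inv (gt_eqF q0) (lt_eqF q1).
eexists; first by [].
exact: (@xgetPex _ 0 (distr_fun mu @^-1` [set q]) (ex_intro _ x xq)).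
Qed.

End quantile.

(** * The isoperimetric inequality *)

Section perimeter.
Context {R : realType} (mu : probability (measurableTypeR R) R)
  (f : R -> \bar R).
Context (hmu : log_convex_class mu f).
Local Notation lam := (@lebesgue_measure R).
Implicit Types (A B E G : set (measurableTypeR R)) (x y b c u q : R).

Lemma perimeter_mod_null A B : measurable A -> measurable B ->
  eq_mod_null A B -> perimeter f A = perimeter f B.
Proof.
by move=> mA mB AB; rewrite /perimeter (ess_boundary_mod_null mA mB AB).
Qed.

Lemma perimeter_setC E : measurable E -> perimeter f (~` E) = perimeter f E.
Proof. by move=> mE; rewrite /perimeter ess_boundary_setC. Qed.

Lemma perimeter_oppr E : measurable E ->
  perimeter f (-%R @^-1` E) = perimeter f E.
Proof.
move=> mE; rewrite /perimeter.
rewrite [RHS](@reindex_esum _ _ _ (ess_boundary (-%R @^-1` E)) _ -%R).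
  by apply: eq_esum => x _; rewrite (lcf_even hmu).
split=> [x /(ess_boundary_oppr _ mE)//|x y _ _ /oppr_inj//|x Ex].
exists (- x); last exact: opprK.
by apply/(ess_boundary_oppr _ mE); rewrite opprK.
Qed.

Lemma esum_set2 (S : set R) x y : x != y -> S = [set x; y] ->
  (\esum_(i in S) f i = f x + f y)%E.
Proof.
move=> xy ->; rewrite esum_fset//; last by move=> i _; exact: (lcf_ge0 hmu).
rewrite fsbigU//; last by move=> z [-> /eqP]; rewrite (negbTE xy).
by rewrite !fsbig_set1.
Qed.

Lemma perimeter_ge1 E x : ess_boundary E x -> (f x <= perimeter f E)%E.
Proof.
move=> Ex; apply: esum_ge; exists [set x]; last by rewrite fsbig_set1.
by split; [exact: finite_set1|move=> y ->].
Qed.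

Lemma perimeter_ge2 E x y : x != y -> ess_boundary E x -> ess_boundary E y ->
  (f x + f y <= perimeter f E)%E.
Proof.
move=> xy Ex Ey; apply: esum_ge; exists [set x; y].
  by split; [exact: finite_set2|move=> z [->|->]].
rewrite -esum_fset//; last by move=> i _; exact: (lcf_ge0 hmu).
by rewrite (esum_set2 xy).
Qed.

Lemma two_raysE b : two_rays b%:E = `]-oo, - b[ `|` `]b, +oo[ :> set R.
Proof.
by apply/seteqP; split=> x; rewrite /two_rays/= !in_itv/= andbT !lte_fin.
Qed.

Lemma sym_itvE b : sym_itv b%:E = `]- b, b[%classic :> set R.
Proof. by apply/seteqP; split=> x; rewrite /sym_itv/= !in_itv/= !lte_fin. Qed.

Lemma measurable_two_rays b :
  measurable (two_rays b%:E : set (measurableTypeR R)).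
Proof. by rewrite two_raysE; exact: measurableU. Qed.

Lemma measurable_sym_itv b :
  measurable (sym_itv b%:E : set (measurableTypeR R)).
Proof. by rewrite sym_itvE. Qed.

Lemma two_rays_setC b : eq_mod_null (~` (two_rays b%:E : set R)) (sym_itv b%:E).
Proof.
rewrite /eq_mod_null; apply: (@subset_measure0 _ _ _ lam _ [set - b; b]).
- apply: measurableU; apply: measurableD; rewrite ?sym_itvE//;
  by apply: measurableC; exact: measurable_two_rays.
- exact: measurableU.
- rewrite two_raysE sym_itvE => x; rewrite /setY/= !in_itv/= andbT.
  have T : true by [].
  have F : ~ false by [].
  by have [xb|xb|xb] := ltgtP x (- b); have [xb'|xb'|xb'] := ltgtP x b => /=;
    tauto.
- apply/eqP; rewrite -measure_le0 -[leRHS]adde0.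
  rewrite -[X in (X + _)%E](lebesgue_measure_set1 (- b)).
  rewrite -[X in (_ + X)%E](lebesgue_measure_set1 b).
  exact: measureU2.
Qed.

(** A point other than [- b] and [b] has a ball, of radius the distance between [|x|] and [b],
    inside the interval or disjoint from it. At [- b] the interval fills the right half of small
    balls; at [b] its complement does. *)
Lemma ess_boundary_sym_itv b : 0 < b ->
  ess_boundary (sym_itv b%:E : set R) = [set - b; b].
Proof.
move=> b0; have mS := measurable_sym_itv b.
rewrite sym_itvE in mS *.
apply/seteqP; split=> [x|x [->|->]].
- apply: contraPP => /= /not_orP[/eqP xNb /eqP xb].
  have [xltb|bltx] := ltP `|x| b.
    rewrite -ess_boundary_setC//.
    apply: (@null_notin_ess_boundary _ _ _ (b - `|x|)); rewrite ?subr_gt0//.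
      exact: measurableC.
    rewrite (_ : _ `&` _ = set0) ?measure0//; apply/seteqP; split=> // y [+].
    rewrite ball_itv/= !in_itv/= => nyb /andP[h1 h2]; apply: nyb.
    by apply/andP; split; [have := lerNnormlW (lexx `|x|)|have := ler_norm x];
      lra.
  apply: (@null_notin_ess_boundary _ _ _ (`|x| - b)) => //.
    rewrite subr_gt0 lt_neqAle bltx andbT.
    by have [x0|x0] := leP 0 x; [rewrite ger0_norm//|rewrite ltr0_norm//]; lra.
  rewrite (_ : _ `&` _ = set0) ?measure0//; apply/seteqP; split=> // y.
  rewrite ball_itv/= !in_itv/= => -[/andP[h1 h2] /andP[]].
  by have [x0|x0] := leP 0 x; [rewrite ger0_norm|rewrite ltr0_norm]; lra.
- apply: (@half_ess_boundary _ _ _ b) => //.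
    rewrite (_ : _ `&` _ = set0) ?measure0//; apply/seteqP; split=> // y.
    by rewrite /= !in_itv/= => -[/andP[h1 h2] /andP[]]; lra.
  rewrite (_ : _ `\` _ = set0) ?measure0//; apply/seteqP; split=> // y.
  by rewrite /= !in_itv/= => -[/andP[h1 h2]]; apply; lra.
- rewrite -ess_boundary_setC//.
  apply: (@half_ess_boundary _ _ _ b) => //; first exact: measurableC.
    rewrite (_ : _ `&` _ = set0) ?measure0//; apply/seteqP; split=> // y.
    by rewrite /= !in_itv/= => -[+ /andP[h1 h2]]; apply; lra.
  rewrite (_ : _ `\` _ = set0) ?measure0//; apply/seteqP; split=> // y.
  by rewrite /= !in_itv/= => -[/andP[h1 h2]]; apply => /andP[]; lra.
Qed.

Lemma perimeter_sym_itv b : 0 < b ->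
  perimeter f (sym_itv b%:E) = (2 * fine (f b))%:E.
Proof.
move=> b0; rewrite /perimeter (esum_set2 _ (ess_boundary_sym_itv b0)); last lra.
by rewrite (lcf_even hmu) (lcf_EFin hmu (lt0r_neq0 b0)) -EFinD/= mulr_natl
  mulr2n.
Qed.

Lemma perimeter_two_rays b : 0 < b ->
  perimeter f (two_rays b%:E) = (2 * fine (f b))%:E.
Proof.
move=> b0; rewrite -(perimeter_sym_itv b0).
rewrite -(perimeter_setC (measurable_two_rays b)).
apply: perimeter_mod_null (two_rays_setC b); last exact: measurable_sym_itv.
by apply: measurableC; exact: measurable_two_rays.
Qed.

Lemma prob_mod_null A B : measurable A -> measurable B ->
  eq_mod_null A B -> mu A = mu B.
Proof.
move=> mA mB /(eq_mod_nullP mA mB)[/(lcf_null hmu (measurableD mA mB)) AB].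
move=> /(lcf_null hmu (measurableD mB mA)) BA.
by apply/eqP; rewrite eq_le !le_measure_mod_null.
Qed.

Lemma prob_two_rays b : 0 < b -> fine (mu (two_rays b%:E)) = 2 * tail mu b.
Proof.
move=> b0; rewrite two_raysE prob_setU//; last first.
  apply/seteqP; split=> // x; rewrite /= !in_itv/= andbT => -[]; lra.
rewrite (_ : fine (mu `]-oo, - b[%classic) = tail mu b);
  first by rewrite mulr_natl mulr2n.
by rewrite /tail -[in RHS](lcf_sym hmu)// opp_preimage_itvbndy.
Qed.

Lemma prob_setC A : measurable A -> fine (mu (~` A)) = 1 - fine (mu A).
Proof. by move=> mA; rewrite probability_setC// fineB// prob_fin_num. Qed.

Lemma prob_sym_itv b : 0 < b -> fine (mu (sym_itv b%:E)) = 1 - 2 * tail mu b.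
Proof.
move=> b0; rewrite -prob_two_rays// -prob_setC; last exact: measurable_two_rays.
congr fine; apply: esym; apply: prob_mod_null (two_rays_setC b).
  by apply: measurableC; exact: measurable_two_rays.
exact: measurable_sym_itv.
Qed.

(** Cancelling the finite mass of the intersection leaves [B] minus [A] without mass, and [lcf_null]
    transfers this to Lebesgue measure. This is how the extremal sets are recognized. *)
Lemma eq_mod_null_le A B : measurable A -> measurable B ->
  lam (A `\` B) = 0%E -> (mu B <= mu A)%E -> eq_mod_null A B.
Proof.
move=> mA mB AB0 BA; apply/(eq_mod_nullP mA mB); split => //.
have mAB := measurableD mA mB; have mBA := measurableD mB mA.
apply/(lcf_null hmu mBA); move/(lcf_null hmu mAB) : AB0 => AB0.
have eA : mu A = (mu (A `\` B) + mu (A `&` B))%E := measureDI mu mA mB.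
have eB : mu B = (mu (B `\` A) + mu (B `&` A))%E := measureDI mu mB mA.
have mI := measurableI _ _ mA mB.
move: BA; rewrite eA eB AB0 add0e [B `&` A]setIC.
by rewrite -leeBrDr ?prob_fin_num// subee ?prob_fin_num// measure_le0 => /eqP.
Qed.

End perimeter.

(** * Case analysis on the boundary points in []- b, b[] *)

Section isoperimetry.
Context {R : realType} (mu : probability (measurableTypeR R) R)
  (f : R -> \bar R).
Context (hmu : log_convex_class mu f).
Local Notation lam := (@lebesgue_measure R).
Implicit Types (A B E G : set (measurableTypeR R)) (x y b c u q : R).

Lemma tail_lt x y : x < y -> tail mu y < tail mu x.
Proof.
move=> xy; rewrite lt_neqAle (tail_ltW hmu xy) andbT; apply/eqP => txy.
have : mu `[x, y]%classic = 0%E.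
  by rewrite -[LHS]fineK ?prob_fin_num// (prob_itv_cc hmu xy) txy subrr.
move/(lcf_null hmu (measurable_itv _));
  rewrite lebesgue_measure_itv/= lte_fin xy.
by move=> [/eqP]; rewrite subr_eq0 gt_eqF.
Qed.

Lemma tail_inv q : 0 < q < 1 -> exists c, tail mu c = q.
Proof.
move=> /(distr_fun_surj hmu)[z <-]; exists (- z).
by rewrite -(distr_funN hmu) opprK.
Qed.

(** The mass of [G] is only bounded below, so that this applies both to a set of mass [2 * tail b]
    and to its complement. When [tail x0 >= 2 * tail b] the point [x0] alone is enough; otherwise a
    [c] completing the tail at [x0] to [2 * tail b] locates a second boundary point. *)
Lemma lt_perimeter_null_left b x0 G : measurable G -> 0 <= x0 -> x0 < b ->
  ((2 * tail mu b)%:E <= mu G)%E -> ess_boundary G x0 ->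
  (forall x, `|x| < b -> ess_boundary G x -> x = x0) ->
  lam (G `&` `]- b, x0[) = 0%E ->
  ((2 * fine (f b))%:E < perimeter f G)%E.
Proof.
move=> mG x00 xb Gp Gx0 uniq null; have b0 : 0 < b by lra.
have [dbl|lt2] := leP (2 * tail mu b) (tail mu x0).
  exact: lt_le_trans (lcf_tail_double hmu x00 xb dbl) (perimeter_ge1 f Gx0).
have tlt := tail_lt xb.
have [c tc] : exists c, tail mu c = 2 * tail mu b - tail mu x0.
  apply: tail_inv; rewrite subr_gt0 lt2/=.
  have : tail mu b <= 1 by apply: prob_le1.
  lra.
have bc : b < c.
  rewrite ltNge; apply/negP; rewrite le_eqVlt => /predU1P[cb|/(tail_ltW hmu)];
    last lra.
  by move: tc; rewrite cb; lra.
(* As [x0] is the only boundary point in []- b, b[], such an [a] satisfies [- c <= a <= - b], whence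
   [f a >= f c]. *)
suff [a /andP[ca ax] Ga] : exists2 a, - c <= a < x0 & ess_boundary G a.
  have ab : a <= - b.
    rewrite leNgt; apply/negP => ba; suff : a = x0 by lra.
    by apply: uniq => //; rewrite ltr_norml ba; lra.
  apply: lt_le_trans (perimeter_ge2 hmu (_ : x0 != a) Gx0 Ga);
    last by rewrite gt_eqF.
  apply: lt_le_trans (lcf_tail_convex hmu x00 xb bc _) _.
    by rewrite tc; lra.
  apply: leeD => //; rewrite -(lcf_even hmu a).
  move: ca; rewrite le_eqVlt => /predU1P[<-|ca]; first by rewrite opprK.
  by apply: ltW; apply: (lcf_lt hmu); rewrite ger0_norm; lra.
(* Otherwise [G] would coincide with [W] below, which has [- c] in its essential
   boundary. *)
apply: contrapT => nobd.
have cx0 : - c < x0 by lra.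
have nbd x : - c < x < x0 -> ~ ess_boundary G x.
  by move=> /andP[cx xx0] Gx; apply: nobd; exists x => //; rewrite (ltW cx).
(* [G] cannot be conull in []- c, x0[], being null on the subinterval []- b, x0[] of positive
   length. *)
have [nul|ful] := ess_boundary_dichotomy mG cx0 nbd; last first.
  pose I : set (measurableTypeR R) := `]- b, x0[%classic.
  have : (lam I <= lam (G `&` I))%E.
    have mI : measurable I by exact: measurable_itv.
    have mGI : measurable (G `&` I) by exact: measurableI.
    apply: le_measure_mod_null => //.
    apply: (subset_measure0 _ _ _ ful); try exact: measurableD.
    move=> x; rewrite /I/= !in_itv/= => -[/andP[h1 h2] nG]; split; first lra.
    by move=> Gx; apply: nG; split => //; rewrite h1.
  by rewrite /I null lebesgue_measure_itv/= lte_fin; case: ifPn => [_|];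
    rewrite ?lee_fin; lra.
apply: nobd; exists (- c); first by rewrite lexx.
pose W : set (measurableTypeR R) := `]-oo, - c] `|` `[x0, +oo[.
have mW : measurable W by exact: measurableU.
have GW : eq_mod_null G W.
  apply: (eq_mod_null_le hmu) => //.
    apply: (subset_measure0 _ _ _ nul) => //;
      [exact: measurableD|exact: measurableI|].
    move=> x [Gx]; rewrite /W/= !in_itv/= andbT => /not_orP[/negP h1 /negP h2].
    by split => //=; lra.
  (* The mass of [W] is [tail c + tail x0 = 2 * tail b]. *)
  apply: le_trans Gp;
    rewrite -[leLHS]fineK ?prob_fin_num// lee_fin prob_setU//; last first.
    by apply/seteqP; split=> // x; rewrite /= !in_itv/= andbT => -[]; lra.
  rewrite -/(distr_fun mu (- c)) (distr_funN hmu) (mu_itvcy hmu).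
  by rewrite -/(tail mu x0); lra.
rewrite (ess_boundary_mod_null mG mW GW) -(ess_boundary_setC mW).
apply: (@half_ess_boundary _ _ _ (x0 + c)); [exact: measurableC|lra| |].
  rewrite (_ : _ `&` _ = set0) ?measure0//; apply/seteqP; split=> // y.
  rewrite /W/= !in_itv/= => -[+ /andP[h1 h2]]; apply; left; lra.
rewrite (_ : _ `\` _ = set0) ?measure0//; apply/seteqP; split=> // y.
by rewrite /W/= !in_itv/= andbT => -[/andP[h1 h2]]; apply => -[]; lra.
Qed.

(** Either [E] or its complement is null on []- b, x0[]. The complement has mass
    [1 - 2 * tail b >= 2 * tail b], because [2 * tail b <= 1 / 2]. *)
Lemma lt_perimeter_one_point b x0 E : measurable E -> 0 <= x0 -> x0 < b ->
  2 * tail mu b <= 1 / 2 -> mu E = (2 * tail mu b)%:E -> ess_boundary E x0 ->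
  (forall x, `|x| < b -> ess_boundary E x -> x = x0) ->
  ((2 * fine (f b))%:E < perimeter f E)%E.
Proof.
move=> mE x00 xb p12 Ep Ex0 uniq.
have nbd x : - b < x < x0 -> ~ ess_boundary E x.
  move=> /andP[bx xx0] /uniq xeq; suff : x = x0 by lra.
  by apply: xeq; rewrite ltr_norml bx; lra.
have bx0 : - b < x0 by lra.
have [null|full] := ess_boundary_dichotomy mE bx0 nbd.
  by apply: lt_perimeter_null_left uniq null; rewrite ?Ep.
rewrite -(perimeter_setC f mE); have mEC := measurableC mE.
apply: (@lt_perimeter_null_left _ x0) => //.
- by rewrite probability_setC// Ep -EFinD lee_fin; lra.
- by rewrite ess_boundary_setC.
- by move=> x xltb; rewrite ess_boundary_setC//; exact: uniq.
- by rewrite setIC -setDE.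
Qed.

Lemma isoperimetric_alternative b E : measurable E -> 0 < b ->
  2 * tail mu b <= 1 / 2 -> mu E = (2 * tail mu b)%:E ->
  [\/ eq_mod_null E (two_rays b%:E),
      2 * tail mu b = 1 / 2 /\ eq_mod_null E (sym_itv b%:E) |
      ((2 * fine (f b))%:E < perimeter f E)%E].
Proof.
move=> mE b0 p12 Ep.
have mr := measurable_two_rays b; have ms := measurable_sym_itv b.
have fltb x : `|x| < b -> ((fine (f b))%:E < f x)%E.
  by move=> xb; rewrite -(lcf_EFin hmu (lt0r_neq0 b0)) (lcf_lt hmu).
have [[x0 [x0b Ex0]]|none] :=
  pselect (exists x, `|x| < b /\ ess_boundary E x); last first.
  have bb : - b < b by lra.
  have [|nul|ful] := ess_boundary_dichotomy mE bb.
  - by move=> x /andP[bx xb] Ex; apply: none; exists x; rewrite ltr_norml bx.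
  - apply: Or31; apply: (eq_mod_null_le hmu) => //; last first.
      by rewrite Ep -[leLHS]fineK ?prob_fin_num// (prob_two_rays hmu).
    apply/eqP; rewrite -measure_le0 -nul.
    have mI : measurable (E `&` `]- b, b[ : set (measurableTypeR R)).
      exact: measurableI.
    apply: le_measure_mod_null => //; first exact: measurableD.
    have [D1 _] := (eq_mod_nullP (measurableC mr) ms).1 (two_rays_setC b).
    apply: (subset_measure0 _ _ _ D1).
    + by apply: measurableD => //; exact: measurableD.
    + by apply: measurableD => //; exact: measurableC.
    + by move=> x [[Ex nr]]; rewrite sym_itvE => nI; split => // sx; exact: nI.
  (* The interval lies in [E] up to a null set and has mass [1 - 2 * tail b >= 1 / 2 >= mu E], so
     all of these are equal. *)
  - apply: Or32; have SE : eq_mod_null (sym_itv b%:E) E.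
      apply: (eq_mod_null_le hmu) => //.
      by rewrite Ep -[leRHS]fineK ?prob_fin_num// (prob_sym_itv hmu)//
        lee_fin; lra.
    split; last exact: eq_mod_null_sym.
    have := prob_sym_itv hmu b0; rewrite (prob_mod_null hmu ms mE SE) Ep/=; lra.
apply: Or33.
have [[y [yb yx0 Ey]]|uniq] :=
  pselect (exists y, [/\ `|y| < b, x0 != y & ess_boundary E y]).
  apply: lt_le_trans (perimeter_ge2 hmu yx0 Ex0 Ey).
  by rewrite mulr_natl mulr2n EFinD lteD// fltb.
have {}uniq x : `|x| < b -> ess_boundary E x -> x = x0.
  by move=> xb Ex; apply: contrapT => /eqP xx0; apply: uniq; exists x;
    rewrite eq_sym.
have [x00|x00] := leP 0 x0.
  apply: (lt_perimeter_one_point mE x00) uniq => //.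
  by apply: le_lt_trans x0b; exact: ler_norm.
(* Reflection moves a negative [x0] to the positive side. *)
rewrite -(perimeter_oppr hmu mE).
have x0N : 0 <= - x0 by rewrite oppr_ge0 ltW.
have x0Nb : - x0 < b by rewrite -ltr0_norm.
apply: (lt_perimeter_one_point (measurable_preimage_oppr mE) x0N x0Nb p12).
- by rewrite (lcf_sym hmu).
- by apply/(ess_boundary_oppr _ mE); rewrite opprK.
- move=> x xb /(ess_boundary_oppr _ mE) Ex; rewrite -[x]opprK; congr (- _).
  by apply: uniq => //; rewrite normrN.
Qed.

End isoperimetry.

(** * The quantile [beta], the inequality and its equality cases *)

Section quantile_sets.
Context {R : realType} (mu : probability (measurableTypeR R) R)
  (f : R -> \bar R).
Context (hmu : log_convex_class mu f).
Local Notation lam := (@lebesgue_measure R).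
Implicit Types (A B C E : set (measurableTypeR R)) (b p : R).

Lemma eq_mod_null_trans A B C : measurable A -> measurable B -> measurable C ->
  eq_mod_null A B -> eq_mod_null B C -> eq_mod_null A C.
Proof.
move=> mA mB mC AB BC; have mY X Y : measurable X -> measurable Y ->
    measurable (X `+` Y : set (measurableTypeR R)).
  by move=> mX mY; apply: measurableU; exact: measurableD.
have mAB := mY _ _ mA mB; have mBC := mY _ _ mB mC.
apply: (@subset_measure0 _ _ _ lam _ ((A `+` B) `|` (B `+` C))).
- exact: mY.
- exact: measurableU.
- by move=> x; rewrite /setY/=; have [] := pselect (B x); tauto.
- apply/eqP;
    rewrite -measure_le0 -[leRHS]adde0 -[X in (X + _)%E]AB -[X in (_ + X)%E]BC.
  exact: measureU2.
Qed.

(** The point [b] has tail [p / 2 < 1 / 2], while symmetry gives 0 the tail [1 / 2]; as the tail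
    decreases, [b > 0]. *)
Lemma betaP p : 0 < p < 1 ->
  exists b, [/\ beta mu p = b%:E, 0 < b & 2 * tail mu b = p].
Proof.
move=> p01; have [|x xE Fx] := @distr_invE _ _ _ hmu (p / 2); first lra.
have tb : tail mu (- x) = p / 2 by rewrite -(distr_funN hmu) opprK.
exists (- x); split; [by rewrite betaE xE| |by rewrite tb; lra].
have t0 : tail mu 0 = 1 / 2.
  by have := tailN hmu 0; rewrite oppr0; lra.
rewrite ltNge; apply/negP; rewrite le_eqVlt => /predU1P[x0|/(tail_lt hmu)];
  last lra.
by move: tb; rewrite x0; lra.
Qed.

Lemma isoperimetric_inequality b E : measurable E -> 0 < b ->
  2 * tail mu b <= 1 / 2 -> mu E = (2 * tail mu b)%:E ->
  ((2 * fine (f b))%:E <= perimeter f E)%E /\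
  (perimeter f E = (2 * fine (f b))%:E <->
   eq_mod_null E (two_rays b%:E) \/
   2 * tail mu b = 1 / 2 /\ eq_mod_null E (sym_itv b%:E)).
Proof.
move=> mE b0 p12 Ep.
have ray : eq_mod_null E (two_rays b%:E) -> perimeter f E = (2 * fine (f b))%:E.
  move=> h; rewrite -(perimeter_two_rays hmu b0).
  exact: perimeter_mod_null mE (measurable_two_rays b) h.
have itv : eq_mod_null E (sym_itv b%:E) -> perimeter f E = (2 * fine (f b))%:E.
  move=> h; rewrite -(perimeter_sym_itv hmu b0).
  exact: perimeter_mod_null mE (measurable_sym_itv b) h.
have [h|h|lt] := isoperimetric_alternative hmu mE b0 p12 Ep.
- by rewrite ray//; split => //; split => // _; left.
- by rewrite (itv h.2); split => //; split => // _; right.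
split; first exact: ltW.
split=> [e|[/ray|[_ /itv]] //]; last by move: lt; rewrite e ltxx.
Qed.

End quantile_sets.

Theorem theorem3p12 (R : realType) (mu : probability (measurableTypeR R) R)
    (f : R -> \bar R) (hmu : log_convex_class mu f)
    (E : set (measurableTypeR R)) (mE : measurable E)
    (p : R) (hp : mu E = p%:E) :
  [/\ p < 1 / 2 ->
        (perimeter f (two_rays (beta mu p)) <= perimeter f E)%E /\
        (perimeter f E = perimeter f (two_rays (beta mu p)) <->
         eq_mod_null E (two_rays (beta mu p))),
      1 / 2 < p ->
        (perimeter f (sym_itv (alpha mu p)) <= perimeter f E)%E /\
        (perimeter f E = perimeter f (sym_itv (alpha mu p)) <->
         eq_mod_null E (sym_itv (alpha mu p))) &
      p = 1 / 2 ->
        [/\ (perimeter f (two_rays (beta mu p)) <= perimeter f E)%E,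
            perimeter f (two_rays (beta mu p)) =
              perimeter f (sym_itv (alpha mu p)) &
            perimeter f E = perimeter f (two_rays (beta mu p)) <->
              eq_mod_null E (two_rays (beta mu p)) \/
              eq_mod_null E (sym_itv (alpha mu p))]].
Proof.
have p0 : 0 <= p by rewrite -lee_fin -hp measure_ge0.
have p1 : p <= 1 by rewrite -lee_fin -hp probability_le1.
have alphaE : alpha mu p = beta mu (1 - p) by rewrite /beta subKr.
have mEC := measurableC mE.
(* For [p = 0] and [p = 1] the extremal set is empty or the whole line, and [E] agrees with it up to
   a null set. *)
have null_case A : measurable (A : set (measurableTypeR R)) ->
    eq_mod_null E A ->
    (perimeter f A <= perimeter f E)%E /\
    (perimeter f E = perimeter f A <-> eq_mod_null E A).
  by move=> mA EA; rewrite (perimeter_mod_null f mE mA EA).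
split.
- move=> p12; move: p0; rewrite le_eqVlt => /predU1P[p0|p0].
    have -> : two_rays (beta mu p) = set0.
      rewrite betaE -p0 mul0r /distr_inv eqxx/=.
      by apply/seteqP; split => // x [] /=; rewrite ?ltNyr ?ltNge ?leNye ?leey.
    apply: null_case => //; apply/eq_mod_nullP => //; split.
      by rewrite setD0; apply/(lcf_null hmu mE); rewrite hp -p0.
    by rewrite set0D measure0.
  have [|b [-> b0 tb]] := betaP hmu (_ : 0 < p < 1); first lra.
  rewrite (perimeter_two_rays hmu b0).
  have [||h1 h2] := @isoperimetric_inequality _ _ _ hmu b E mE b0.
  + by rewrite tb ltW.
  + by rewrite tb.
  + by split=> //; rewrite h2 tb; split=> [[//|[]]|]; [lra|left].
- move=> p12; move: p1; rewrite le_eqVlt => /predU1P[p1|p1].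
    have -> : sym_itv (alpha mu p) = setT.
      rewrite /alpha p1 subrr mul0r /distr_inv eqxx/=.
      by apply/seteqP; split => // x _; rewrite /sym_itv/= ltNyr ltry.
    apply: null_case => //; apply/eq_mod_nullP => //; split.
      by rewrite setDT measure0.
    rewrite setTD; apply/(lcf_null hmu mEC).
    by rewrite probability_setC// hp p1 subee.
  have [|b [bE b0 tb]] := betaP hmu (_ : 0 < 1 - p < 1); first lra.
  (* The complement has mass [1 - p < 1 / 2] and the same perimeter, and [alpha] at [p] is [beta] at
     [1 - p]. *)
  rewrite alphaE bE (perimeter_sym_itv hmu b0) -(perimeter_setC f mE).
  have mr := measurable_two_rays b; have ms := measurable_sym_itv b.
  have [||h1 h2] := @isoperimetric_inequality _ _ _ hmu b (~` E) mEC b0.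
  + by rewrite tb; lra.
  + by rewrite probability_setC// hp tb.
  + split=> //; rewrite h2 tb; split=> [[h|[]]|h]; last 2 first.
    * lra.
    * left; apply: eq_mod_null_sym; apply/eq_mod_null_setC; rewrite setCK.
      exact: eq_mod_null_trans (measurableC mr) ms mE (two_rays_setC b)
        (eq_mod_null_sym h).
    * apply: eq_mod_null_trans mE (measurableC mr) ms _ (two_rays_setC b).
      by apply/eq_mod_null_setC; rewrite setCK.
- move=> p12; have [|b [bE b0 tb]] := betaP hmu (_ : 0 < p < 1); first lra.
  have -> : alpha mu p = beta mu p by rewrite alphaE; congr beta; lra.
  rewrite bE (perimeter_two_rays hmu b0) (perimeter_sym_itv hmu b0).
  have [||h1 h2] := @isoperimetric_inequality _ _ _ hmu b E mE b0.
  + by rewrite tb p12.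
  + by rewrite tb.
  + by split=> //; rewrite h2 tb; split=> [[|[]]|[]]; by [left|right].
Qed.
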